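(* Let $k$ be an algebraically closed field, let $n\ge1$, and let $F=k\langle\langle x_1,\ldots,x_n\rangle\rangle$. For every derivation $\xi\in\mathrm{Der}_k^+(F)$, there exists a unique pair of derivations $\xi_S,\xi_N\in\mathrm{Der}_k^+(F)$ such that $\xi=\xi_S+\xi_N$, $\xi_S$ is semisimple, $\xi_N$ is nilpotent, and $[\xi_S,\xi_N]=0$. Moreover, any derivation in $\mathrm{Der}_k^+(F)$ commutes with $\xi$ if and only if it commutes with both $\xi_S$ and $\xi_N$.
   Context: $F=k\langle\langle x_1,\ldots,x_n\rangle\rangle$ is the complete free algebra: its elements are formal series $\sum_w a_w w$ with $w$ running over all words in $x_1,\ldots,x_n$ and $a_w\in k$. Let $\mathfrak m$ be the ideal generated by $x_1,\ldots,x_n$ (series with zero constant term). $\mathrm{Der}_k^+(F)$ is the space of $k$-linear derivations $\xi:F\to F$ with $\xi(\mathfrak m)\subseteq\mathfrak m$; derivations of $F$ are automatically continuous for the $\mathfrak m$-adic topology and are determined by their values on $x_1,\ldots,x_n$. The bracket is $[\xi,\eta]=\xi\circ\eta-\eta\circ\xi$. A derivation $\xi\in\mathrm{Der}_k^+(F)$ is called nilpotent if it induces a nilpotent endomorphism of $\mathfrak m/\mathfrak m^2$. It is called semisimple if it has $n$ eigenvectors in $\mathfrak m$ whose classes form a basis of $\mathfrak m/\mathfrak m^2$; equivalently, there is a $k$-algebra automorphism $H$ of $F$ such that $H\circ\xi\circ H^{-1}$ has $x_1,\ldots,x_n$ as eigenvectors. *)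

(* Defs.v *)
From HB Require Import structures.
From mathcomp Require Import all_boot all_order all_algebra.
From mathcomp Require Import all_classical.

Set Implicit Arguments.
Unset Strict Implicit.
Unset Printing Implicit Defensive.

Import GRing.Theory.

Local Open Scope classical_set_scope.
Local Open Scope ring_scope.

(* The complete free algebra R<<x_1, ..., x_n>>: the series \sum_w a_w w is
   the function w |-> a_w on words in the letters 'I_n.  It is an alias of the
   function type so that it can carry the convolution product instead of the
   pointwise one; the linear structure is the pointwise one. *)
Definition ncseries (R : comNzRingType) (n : nat) : Type := seq 'I_n -> R.

HB.instance Definition _ (R : comNzRingType) (n : nat) :=
  GRing.Lmodule.copy (ncseries R n) (seq 'I_n -> R^o).

Section NCSeriesAlgebra.
Variables (R : comNzRingType) (n : nat).
Implicit Types f g h : ncseries R n.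

Definition ncone : ncseries R n := fun w => (w == [::])%:R.

(* The coefficient of w sums over all factorizations w = u v. *)
Definition ncmul f g : ncseries R n :=
  fun w => \sum_(i < (size w).+1) f (take i w) * g (drop i w).

Let shift (a : 'I_n) f : ncseries R n := fun w => f (a :: w).

Let ncmul_nil f g : ncmul f g [::] = f [::] * g [::].
Proof. by rewrite /ncmul big_ord1. Qed.

Let ncmul_cons f g a w :
  ncmul f g (a :: w) = f [::] * g (a :: w) + ncmul (shift a f) g w.
Proof. by rewrite /ncmul big_ord_recl. Qed.

Let addE f g w : (f + g) w = f w + g w. Proof. by []. Qed.
Let scaleE (c : R) f w : (c *: f) w = c * f w. Proof. by []. Qed.

Lemma ncmulDl : left_distributive ncmul +%R.
Proof.
move=> f g h; apply/funext => w; rewrite addE /ncmul -big_split /=.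
by apply: eq_bigr => i _; rewrite addE mulrDl.
Qed.

Lemma ncmulDr : right_distributive ncmul +%R.
Proof.
move=> f g h; apply/funext => w; rewrite addE /ncmul -big_split /=.
by apply: eq_bigr => i _; rewrite addE mulrDr.
Qed.

Lemma ncscaleAl (c : R) f g : c *: ncmul f g = ncmul (c *: f) g.
Proof.
apply/funext => w; rewrite scaleE /ncmul mulr_sumr.
by apply: eq_bigr => i _; rewrite scaleE mulrA.
Qed.

Lemma ncscaleAr (c : R) f g : c *: ncmul f g = ncmul f (c *: g).
Proof.
apply/funext => w; rewrite scaleE /ncmul mulr_sumr.
by apply: eq_bigr => i _; rewrite scaleE mulrCA.
Qed.

Lemma ncmulA : associative ncmul.
Proof.
move=> f g h; apply/funext => w; elim: w f => [|a w IHw] f.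
  by rewrite !ncmul_nil mulrA.
rewrite !ncmul_cons ncmul_nil.
have -> : shift a (ncmul f g) = f [::] *: shift a g + ncmul (shift a f) g.
  by apply/funext => v; rewrite addE scaleE -ncmul_cons.
by rewrite ncmulDl addE -ncscaleAl scaleE -IHw mulrDr mulrA addrA.
Qed.

Lemma ncmul1r : left_id ncone ncmul.
Proof.
move=> f; apply/funext => -[|a w].
  by rewrite ncmul_nil mul1r.
rewrite ncmul_cons mul1r.
have -> : shift a ncone = 0 *: ncone by apply/funext => v; rewrite scaleE mul0r.
by rewrite -ncscaleAl scaleE mul0r addr0.
Qed.

Lemma ncmulr1 : right_id ncone ncmul.
Proof.
move=> f; apply/funext => w; elim: w f => [|a w IHw] f.
  by rewrite ncmul_nil mulr1.
by rewrite ncmul_cons mulr0 add0r IHw.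
Qed.

Lemma ncone_neq0 : ncone != 0.
Proof.
apply/eqP => /(congr1 (fun f : ncseries R n => f [::])) /eqP.
by rewrite (negPf (oner_neq0 R)).
Qed.

HB.instance Definition _ := GRing.Zmodule_isNzRing.Build (ncseries R n)
  ncmulA ncmul1r ncmulr1 ncmulDl ncmulDr ncone_neq0.
HB.instance Definition _ :=
  GRing.Lmodule_isLalgebra.Build R (ncseries R n) ncscaleAl.
HB.instance Definition _ :=
  GRing.Lalgebra_isAlgebra.Build R (ncseries R n) ncscaleAr.

End NCSeriesAlgebra.

Section Derivations.
Variables (k : fieldType) (n : nat).
Local Notation F := (ncseries k n).
Implicit Types (f g : F) (xi eta : F -> F).

Definition maxideal : set F := [set f | f [::] = 0].

Definition ideal_mul (I J : set F) : set F :=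
  [set f | exists r (a b : 'I_r -> F),
     [/\ forall i, I (a i), forall i, J (b i) & f = \sum_(i < r) a i * b i]].

Definition maxideal2 : set F := ideal_mul maxideal maxideal.

Definition derivation xi : Prop :=
  linear xi /\ forall f g, xi (f * g) = xi f * g + f * xi g.

Definition Der_plus : set (F -> F) :=
  [set xi | derivation xi /\ forall f, maxideal f -> maxideal (xi f)].

Definition der_bracket xi eta : F -> F := (xi \o eta) - (eta \o xi).

(* Some power of the endomorphism induced on m / m^2 vanishes. *)
Definition nilpotent_der xi : Prop :=
  exists N : nat, forall f, maxideal f -> maxideal2 (iter N xi f).

Definition eigenvector xi f : Prop :=
  f != 0 /\ exists c : k, xi f = c *: f.

(* The classes of the v i form a basis of m / m^2: they are linearly
   independent and span. *)
Definition basis_mod_maxideal2 (v : 'I_n -> F) : Prop :=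
  [/\ forall i, maxideal (v i),
      forall c : 'I_n -> k,
        maxideal2 (\sum_(i < n) c i *: v i) -> forall i, c i = 0
    & forall f, maxideal f ->
        exists c : 'I_n -> k, maxideal2 (f - \sum_(i < n) c i *: v i)].

Definition semisimple_der xi : Prop :=
  exists v : 'I_n -> F,
    (forall i, eigenvector xi (v i)) /\ basis_mod_maxideal2 v.

Definition jordan_decomposition xi xiS xiN : Prop :=
  [/\ Der_plus xiS /\ Der_plus xiN,
      xi = xiS + xiN,
      semisimple_der xiS,
      nilpotent_der xiN
    & der_bracket xiS xiN = 0].

End Derivations.

(* Main.v *)
From HB Require Import structures.
Require Import Defs.
From mathcomp Require Import all_boot all_order all_algebra.
From mathcomp Require Import all_classical.

Set Implicit Arguments.
Unset Strict Implicit.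
Unset Printing Implicit Defensive.

Import GRing.Theory.
Local Open Scope ring_scope.

(** Write m for the maximal ideal of F.  A positive derivation [xi] preserves
every power m^N, and F / m^N has finite dimension, so [xi] acts on F / m^N by
an endomorphism that has a Jordan decomposition; the point is that these
decompositions are compatible and respect the product.  Instead of forming
quotients, everything is said modulo m^N: [vanish N f] says that f lies in m^N.

Modulo m^N, F is the sum of the generalized eigenspaces of [xi] ([geneig],
[der_geneig_ind]), because some nonzero polynomial in [xi] maps F into m^N
([annihilator], by Cayley-Hamilton).  For any c : k -> k, Chinese remaindering
gives a polynomial p_N such that p_N(xi) is multiplication by c nu on the
generalized eigenspace of nu modulo m^N ([spectral_interpolation]).  The maps
p_N(xi) and p_M(xi) agree modulo m^M for M <= N, so they converge to a
single linear map c(xi) of F ([spectral], [spectral_exists]): a functional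
calculus for locally constant functions on the spectrum.

The semisimple part is S = c(xi) for c the identity.
- It is a derivation ([spectral_der]), because the product of generalized
  eigenvectors for nu and mu is one for nu + mu ([geneigM], from the iterated
  Leibniz rule).
- It is semisimple ([spectral_semisimple]): the maps c(xi) for c the indicator
  of a point are projections onto genuine eigenspaces of S, so every class of
  m / m^2 is a sum of classes of eigenvectors ([spectral_eigen]), from which a
  basis is extracted.
- xi - S is nilpotent ([spectral_nilpotent]), since it acts as xi - nu on the
  generalized eigenspace of nu.
- S commutes with everything that commutes with [xi] ([spectral_comm]), since
  such a map preserves generalized eigenspaces.

For uniqueness ([jordan_spectral]), let xi = xiS + xiN be a decomposition and v
an eigenvector of xiS, of eigenvalue mu.  Then (xi - mu)^e v = xiN^e v, and xiN
is nilpotent modulo each m^N, not just on m / m^2 ([nilpotent_vanish]); so v is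
a generalized eigenvector of [xi] and S v = mu v.  Thus S and xiS agree on a
basis of m / m^2, and two positive derivations that do so are equal
([derivation_ext]). *)

(** * Polynomials in an endomorphism *)

Section PolynomialAction.
Variables (k : fieldType) (V : lmodType k) (xi : {linear V -> V}).
Implicit Types (p q : {poly k}) (u v : V).

(** The value at v of the endomorphism p(xi). *)
Definition pact p v : V := \sum_(i < size p) p`_i *: iter i xi v.

Lemma pact_widen m p v :
  (size p <= m)%N -> pact p v = \sum_(i < m) p`_i *: iter i xi v.
Proof.
move=> le_pm; rewrite /pact (big_ord_widen m (fun i => p`_i *: iter i xi v)) //.
rewrite big_mkcond; apply: eq_bigr => i _; case: ltnP => // le_pi.
by rewrite nth_default ?scale0r.
Qed.

Lemma iter_linearP i (a : k) u v :
  iter i xi (a *: u + v) = a *: iter i xi u + iter i xi v.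
Proof. by elim: i => //= i ->; rewrite linearP. Qed.

Lemma pactP p (a : k) u v : pact p (a *: u + v) = a *: pact p u + pact p v.
Proof.
rewrite /pact scaler_sumr -big_split; apply: eq_bigr => i _ /=.
by rewrite iter_linearP scalerDr !scalerA mulrC.
Qed.

Lemma pactDr p u v : pact p (u + v) = pact p u + pact p v.
Proof. by rewrite -{1}[u]scale1r pactP scale1r. Qed.

Lemma pactDl p q v : pact (p + q) v = pact p v + pact q v.
Proof.
pose m := maxn (size p) (size q).
rewrite (@pact_widen m (p + q)) ?size_polyD //.
rewrite (@pact_widen m p) ?leq_maxl // (@pact_widen m q) ?leq_maxr //.
by rewrite -big_split; apply: eq_bigr => i _; rewrite coefD scalerDl.
Qed.

Lemma pactZl (a : k) p v : pact (a *: p) v = a *: pact p v.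
Proof.
rewrite (@pact_widen (size p)) ?size_scale_leq // scaler_sumr.
by apply: eq_bigr => i _; rewrite coefZ scalerA.
Qed.

Lemma pactC (a : k) v : pact a%:P v = a *: v.
Proof.
by rewrite (@pact_widen 1) ?size_polyC_leq1 // big_ord1 coefC eqxx.
Qed.

Lemma pactX p v : pact (p * 'X) v = xi (pact p v).
Proof.
rewrite (@pact_widen (size p).+1) ?(leq_trans (size_polyMleq _ _)) //;
  last first.
  by rewrite size_polyX addn2.
rewrite big_ord_recl coefMX eqxx scale0r add0r linear_sum.
by apply: eq_bigr => i _; rewrite coefMX linearZ.
Qed.

Lemma pactM p q v : pact (p * q) v = pact p (pact q v).
Proof.
elim/poly_ind: p => [|p c IHp].
  by rewrite mul0r /pact size_poly0 !big_ord0.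
rewrite mulrDl !pactDl -mulrA ['X * q]mulrC mulrA !pactX IHp.
by rewrite mul_polyC pactZl pactC.
Qed.

Lemma pact1 v : pact 1 v = v.
Proof. by rewrite -[1]/(1%:P) pactC scale1r. Qed.

Lemma pactXsubC (a : k) v : pact ('X - a%:P) v = xi v - a *: v.
Proof.
by rewrite -['X]mul1r -polyCN pactDl pactX pact1 pactC scaleNr.
Qed.

Lemma pactXsubCn (a : k) e v :
  pact (('X - a%:P) ^+ e) v = iter e (fun w => xi w - a *: w) v.
Proof.
by elim: e => [|e IHe]; rewrite ?pact1 // exprS pactM IHe pactXsubC.
Qed.

Definition stable_submod (U : V -> Prop) : Prop :=
  [/\ U 0, forall (a : k) u v, U u -> U v -> U (a *: u + v)
    & forall u, U u -> U (xi u)].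

End PolynomialAction.

(** * Chinese remaindering at powers of linear factors *)

Section Interpolation.
Variable k : fieldType.

Lemma coprimep_XsubC_exp (a b : k) d e :
  a != b -> coprimep (('X - a%:P) ^+ d) (('X - b%:P) ^+ e).
Proof.
move=> ab; rewrite coprimep_expl // coprimep_expr // coprimep_XsubC2 //.
by rewrite subr_eq0 eq_sym.
Qed.

Lemma coprimep_prod_XsubC_exp (s : seq k) E (nu : k) e : nu \notin s ->
  coprimep (\prod_(z <- s) ('X - z%:P) ^+ E) (('X - nu%:P) ^+ e).
Proof.
elim: s => [|z s IHs]; first by rewrite big_nil coprime1p.
rewrite inE negb_or big_cons coprimepMl => /andP[nu_z nu_s].
by rewrite IHs // coprimep_XsubC_exp // eq_sym.
Qed.

Lemma bezout1 (p q : {poly k}) :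
  coprimep p q -> exists u v : {poly k}, u * p + v * q = 1.
Proof.
case/Bezout_eq1_coprimepP=> -[u v] /= E.
by exists u, v.
Qed.

(** Hermite interpolation of the jets of locally constant functions: one point
is added at a time, using a Bezout relation between its factor and the product
Q of the others to correct the previous interpolant by a multiple of Q. *)
Lemma interpolation (s : seq k) E (c : k -> k) : uniq s ->
  exists p : {poly k}, forall z, z \in s -> ('X - z%:P) ^+ E %| p - (c z)%:P.
Proof.
elim: s => [_|z s IHs /= /andP[z_s /IHs[p p_s]]]; first by exists 0.
have [u [v uv1]] := bezout1 (coprimep_prod_XsubC_exp E E z_s).
set Q := \prod_(_ <- _) _ in uv1.
exists (p + u * Q * ((c z)%:P - p)) => y; rewrite inE => /predU1P[->|y_s].
  have -> : p + u * Q * ((c z)%:P - p) - (c z)%:P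
            = v * ('X - z%:P) ^+ E * (p - (c z)%:P).
    have -> : v * ('X - z%:P) ^+ E = 1 - u * Q.
      by rewrite -uv1 [u * Q + _]addrC addrK.
    by rewrite mulrBl mul1r -mulrN opprB addrAC.
  by rewrite dvdp_mulr // dvdp_mull.
rewrite addrAC dvdp_add ?p_s // dvdp_mulr // dvdp_mull //.
by rewrite /Q (big_rem y) //= dvdp_mulr.
Qed.

End Interpolation.

(** * Generalized eigenvectors modulo a submodule of finite codimension *)

(** Algebraic closedness as a property, so that all rings and modules below are
built on the field structure alone. *)
Definition polynomials_split (k : fieldType) : Prop := forall p : {poly k},
  exists r : seq k, p = lead_coef p *: \prod_(z <- r) ('X - z%:P).

Section FiniteCodimension.
Variables (k : fieldType) (k_closed : polynomials_split k).
Variables (V : lmodType k) (xi : {linear V -> V}).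

Variables (U : V -> Prop) (stabU : stable_submod xi U).
Implicit Types (p q : {poly k}) (u v : V).

Lemma submodD u v : U u -> U v -> U (u + v).
Proof. by case: stabU => _ UP _ Uu Uv; rewrite -[u]scale1r; apply: UP. Qed.

Lemma submodZ (a : k) u : U u -> U (a *: u).
Proof. by case: stabU => U0 UP _ Uu; rewrite -[a *: u]addr0; apply: UP. Qed.

Lemma submod_pact p u : U u -> U (pact xi p u).
Proof.
case: (stabU) => U0 _ Uxi Uu; rewrite /pact.
elim/big_ind: _ => // [|i _]; first exact: submodD.
by apply: submodZ; elim: (i : nat) => //= j /Uxi.
Qed.

Lemma submod_dvdp p q v : p %| q -> U (pact xi p v) -> U (pact xi q v).
Proof.
by move=> /Pdiv.Field.dvdpP[r ->]; rewrite pactM; apply: submod_pact.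
Qed.

Lemma submod_coprimep p q v : coprimep p q ->
  U (pact xi p v) -> U (pact xi q v) -> U v.
Proof.
move=> /bezout1[a [b ab1]] Up Uq.
rewrite -[v](pact1 xi) -ab1 pactDl !pactM.
by apply: submodD; apply: submod_pact.
Qed.

Lemma dvdp_prod_XsubC_exp (r s : seq k) : {subset r <= s} ->
  \prod_(z <- r) ('X - z%:P) %| \prod_(z <- s) ('X - z%:P) ^+ size r.
Proof.
elim: r => [|y r IHr] rs; first by rewrite big_nil dvd1p.
rewrite big_cons /=; under [X in _ %| X]eq_bigr do rewrite exprS.
rewrite big_split /= dvdp_mul ?IHr //.
  by rewrite (big_rem y) ?rs ?mem_head //= dvdp_mulr.
by move=> z z_r; apply: rs; rewrite inE z_r orbT.
Qed.

Lemma annihilator_distinct_roots chi : chi != 0 ->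
  exists s : seq k, exists2 E : nat,
    uniq s & chi %| \prod_(z <- s) ('X - z%:P) ^+ E.
Proof.
move=> chi0; have [r Dchi] := k_closed chi.
exists (undup r), (size r); first exact: undup_uniq.
rewrite {1}Dchi dvdpZl ?lead_coef_eq0 //.
by apply: dvdp_prod_XsubC_exp => z; rewrite mem_undup.
Qed.

Variables (chi : {poly k}) (chi_neq0 : chi != 0).
Hypothesis chiU : forall v, U (pact xi chi v).

(** Primary decomposition of V / U, in the form of an induction principle: an
additive predicate holds everywhere as soon as it holds at the generalized
eigenvectors modulo U.  One exponent E serves for all of them, which is what
makes nilpotency of the nilpotent part uniform. *)
Lemma geneig_ind : exists E : nat, forall P : V -> Prop,
  (forall u v, P u -> P v -> P (u + v)) ->
  (forall nu v, U (pact xi (('X - nu%:P) ^+ E) v) -> P v) -> forall v, P v.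
Proof.
have [s [E s_uniq chi_s]] := annihilator_distinct_roots chi_neq0.
exists E => P PD PE v.
have: U (pact xi (\prod_(z <- s) ('X - z%:P) ^+ E) v).
  exact: submod_dvdp chi_s (chiU v).
elim: s s_uniq v {chi_s} => [_ v|z s IHs /= /andP[z_s s_uniq] v].
  by rewrite big_nil pact1 => Uv; apply: (PE 0); apply: submod_pact.
rewrite big_cons => Uv.
have [a [b ab1]] := bezout1 (coprimep_prod_XsubC_exp E E z_s).
rewrite -[v](pact1 xi) -ab1 pactDl; apply: PD.
  apply: (PE z); rewrite -pactM mulrCA pactM; exact: submod_pact.
apply: IHs => //; rewrite -pactM mulrCA pactM [_ * (_ ^+ E)]mulrC.
exact: submod_pact.
Qed.

(** On the part of V / U where xi - nu is nilpotent, p(xi) is multiplication by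
c nu: at a root nu of the annihilator because (X - nu)^E divides p - c nu, and
elsewhere because that part of V / U is zero. *)
Lemma spectral_interpolation (c : k -> k) : exists p, forall nu e v,
  U (pact xi (('X - nu%:P) ^+ e) v) -> U (pact xi p v - c nu *: v).
Proof.
have [s [E s_uniq chi_s]] := annihilator_distinct_roots chi_neq0.
have [p p_s] := interpolation E c s_uniq.
exists p => nu e v Uv.
have sU : U (pact xi (\prod_(z <- s) ('X - z%:P) ^+ E) v).
  exact: submod_dvdp chi_s (chiU v).
rewrite -scaleNr -(pactC xi) polyCN -pactDl.
have [nu_s|nu_s] := boolP (nu \in s); last first.
  apply: submod_pact.
  exact: submod_coprimep (coprimep_prod_XsubC_exp E e nu_s) sU Uv.
apply: (submod_dvdp (p_s nu nu_s)).
(* Since (X - nu)^e kills v modulo U, the factors of the annihilator at the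
   other roots are invertible on v: already (X - nu)^E kills it. *)
apply: (@submod_coprimep (\prod_(z <- rem nu s) ('X - z%:P) ^+ E)
          (('X - nu%:P) ^+ e)).
- by apply: coprimep_prod_XsubC_exp; rewrite mem_rem_uniqF.
- by rewrite -pactM mulrC; move: sU; rewrite (big_rem nu).
- by rewrite -pactM mulrC pactM; apply: submod_pact.
Qed.

End FiniteCodimension.

(** * The filtration of the complete free algebra by powers of its ideal *)

Section Filtration.
Variables (k : fieldType) (n : nat).
Local Notation F := (ncseries k n).
Implicit Types (f g : F) (w : seq 'I_n).

(** Membership in m^N, read on coefficients. *)
Definition vanish N f : Prop := forall w, (size w < N)%N -> f w = 0.

Definition ncvar (i : 'I_n) : F := fun w => (w == [:: i])%:R.

Definition ncshift (i : 'I_n) f : F := fun w => f (i :: w).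

Lemma ncseries1E w : (1 : F) w = (w == [::])%:R. Proof. by []. Qed.
Lemma ncseriesDE f g w : (f + g) w = f w + g w. Proof. by []. Qed.
Lemma ncseriesNE f w : (- f) w = - f w. Proof. by []. Qed.
Lemma ncseriesZE (a : k) f w : (a *: f) w = a * f w. Proof. by []. Qed.

Lemma ncseries_sumE (I : Type) (r : seq I) (P : pred I) (f : I -> F) w :
  (\sum_(i <- r | P i) f i) w = \sum_(i <- r | P i) f i w.
Proof. by elim/big_rec2: _ => // i a u _ <-. Qed.

Lemma ncmulE f g w :
  (f * g) w = \sum_(i < (size w).+1) f (take i w) * g (drop i w).
Proof. by []. Qed.

Lemma vanish_lin N (a : k) f g :
  vanish N f -> vanish N g -> vanish N (a *: f + g).
Proof.
by move=> vf vg w wN; rewrite ncseriesDE ncseriesZE vf // vg // mulr0 addr0.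
Qed.

Lemma vanish0 N : vanish N (0 : F). Proof. by []. Qed.

Lemma vanishD N f g : vanish N f -> vanish N g -> vanish N (f + g).
Proof. by move=> vf vg; rewrite -[f]scale1r; apply: vanish_lin. Qed.

Lemma vanishZ N (a : k) f : vanish N f -> vanish N (a *: f).
Proof. by move=> vf; rewrite -[_ *: _]addr0; apply: vanish_lin. Qed.

Lemma vanishN N f : vanish N f -> vanish N (- f).
Proof. by move=> vf; rewrite -scaleN1r; apply: vanishZ. Qed.

Lemma vanishB N f g : vanish N f -> vanish N g -> vanish N (f - g).
Proof. by move=> vf vg; apply: vanishD => //; apply: vanishN. Qed.

Lemma vanish_sum N (I : Type) (r : seq I) (P : pred I) (f : I -> F) :
  (forall i, P i -> vanish N (f i)) -> vanish N (\sum_(i <- r | P i) f i).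
Proof. by move=> vf; elim/big_ind: _ => //; apply: vanishD. Qed.

Lemma vanish_leq M N f : (M <= N)%N -> vanish N f -> vanish M f.
Proof. by move=> MN vf w wM; apply: vf; apply: leq_trans MN. Qed.

Lemma vanish_trans N f g h :
  vanish N (f - g) -> vanish N (g - h) -> vanish N (f - h).
Proof. by move=> fg gh; rewrite -[f](subrK g) -addrA; apply: vanishD. Qed.

Lemma vanish_sym N f g : vanish N (f - g) -> vanish N (g - f).
Proof. by move=> /vanishN; rewrite opprB. Qed.

Lemma vanish_all f : (forall N, vanish N f) -> f = 0.
Proof. by move=> vf; apply/funext => w; apply: (vf (size w).+1). Qed.

Lemma vanish1P f : vanish 1 f <-> maxideal f.
Proof. by split=> [vf | f0 [|a w] //]; apply: vf. Qed.

Lemma vanishM M N f g : vanish M f -> vanish N g -> vanish (M + N) (f * g).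
Proof.
move=> vf vg w wMN; rewrite ncmulE big1 // => i _.
have iw : (i <= size w)%N by rewrite -ltnS.
have [iM|Mi] := ltnP i M; first by rewrite vf ?mul0r // size_takel.
rewrite vg ?mulr0 // size_drop.
by rewrite ltn_subLR // (leq_trans wMN) // leq_add2r.
Qed.

Lemma vanish_var i : vanish 1 (ncvar i).
Proof. by case. Qed.

Lemma vanish_shift N i f : vanish N.+1 f -> vanish N (ncshift i f).
Proof. by move=> vf w wN; apply: vf. Qed.

Lemma ncvarME i f w :
  (ncvar i * f) w = if w is j :: v then (j == i)%:R * f v else 0.
Proof.
rewrite ncmulE; case: w => [|j v]; first by rewrite big_ord1 /ncvar mul0r.
rewrite big_ord_recl {1}/ncvar mul0r add0r big_ord_recl /= take0 drop0.
rewrite {1}/ncvar eqseq_cons eqxx andbT big1 ?addr0 // => l _.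
rewrite {1}/ncvar eqseq_cons /=; case: v l => [|b v] l; first by case: l.
by rewrite andbF mul0r.
Qed.

Lemma ncseries_expand f : f = f [::] *: 1 + \sum_i ncvar i * ncshift i f.
Proof.
apply/funext => w; rewrite ncseriesDE ncseriesZE ncseries_sumE.
case: w => [|j v].
  rewrite big1 ?addr0 => [|i _]; last by rewrite ncvarME.
  by rewrite ncseries1E mulr1.
rewrite (bigD1 j) //= ncvarME eqxx mul1r big1 => [|i ij].
  by rewrite ncseries1E mulr0 add0r addr0.
by rewrite ncvarME eq_sym (negPf ij) mul0r.
Qed.

Lemma maxideal_expand f : maxideal f -> f = \sum_i ncvar i * ncshift i f.
Proof.
by move=> f0; rewrite {1}[f]ncseries_expand [f [::]]f0 scale0r add0r.
Qed.

(** A series without terms of degree less than 2 is the sum of the x_i f_i with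
f_i in m, so the ideal m^2, defined by finite sums, has the expected
coefficientwise description. *)
Lemma vanish2P f : vanish 2 f <-> maxideal2 f.
Proof.
split=> [vf | [r [a [b [ma mb ->]]]]].
  exists n, ncvar, (fun i => ncshift i f); split=> [i|i|].
  - exact/vanish1P/vanish_var.
  - exact/vanish1P/vanish_shift.
  - exact/maxideal_expand/vanish1P/(vanish_leq _ vf).
apply: vanish_sum => i _; apply: (@vanishM 1 1); exact/vanish1P.
Qed.

(** The class of f in m / m^2, in the coordinates x_1, ..., x_n. *)
Definition linpart f : 'rV[k]_n := \row_i f [:: i].

Lemma linpartP (a : k) f g : linpart (a *: f + g) = a *: linpart f + linpart g.
Proof. by apply/rowP => i; rewrite !mxE. Qed.

Lemma linpart_sum (I : Type) (r : seq I) (P : pred I) (c : I -> k)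
    (f : I -> F) :
  linpart (\sum_(i <- r | P i) c i *: f i)
  = \sum_(i <- r | P i) c i *: linpart (f i).
Proof.
elim/big_rec2: _ => [|i u v _ <-]; last exact: linpartP.
by apply/rowP => i; rewrite !mxE.
Qed.

Lemma vanish2_linpart f : maxideal f -> vanish 2 f <-> linpart f = 0.
Proof.
move=> f0; split=> [vf|lf [|a [|b w]] // _].
  by apply/rowP => i; rewrite !mxE vf.
by have := congr1 (fun u : 'rV_n => u 0 a) lf; rewrite !mxE.
Qed.

End Filtration.

(** * Positive derivations *)

(** The iterated Leibniz rule without binomial coefficients: the e-th iterate of
c at f g is a sum of terms (a^i f) (b^j g) with i + j = e, so that an additive
predicate can be checked on these.  It is used with a = D - nu, b = D - mu and
c = D - (nu + mu), for a derivation D. *)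
Lemma iter_leibniz (A : pzRingType) (c a b : A -> A) (P : A -> Prop) :
  (forall f g, c (f + g) = c f + c g) ->
  (forall f g, c (f * g) = a f * g + f * b g) ->
  (forall f g, P f -> P g -> P (f + g)) ->
  forall e f g,
    (forall i j, (i + j)%N = e -> P (iter i a f * iter j b g)) ->
    P (iter e c (f * g)).
Proof.
move=> cD cM PD; elim=> [|e IHe] f g Pfg; first exact: (Pfg 0 0).
have iterD u v : iter e c (u + v) = iter e c u + iter e c v.
  by elim: e {IHe Pfg} => //= e ->.
rewrite iterSr cM iterD; apply: PD; apply: IHe => i j ij.
  by rewrite -iterSr; apply: Pfg; rewrite addSn ij.
by rewrite -[iter j b (b g)]iterSr; apply: Pfg; rewrite addnS ij.
Qed.

Section PositiveDerivations.
Variables (k : fieldType) (n : nat).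
Local Notation F := (ncseries k n).
Implicit Types (f g : F).

Lemma Der_plus_linear (xi : F -> F) :
  Der_plus xi -> exists L : {linear F -> F}, xi = L.
Proof.
case=> -[lin_xi _] _.
pose i := GRing.isLinear.Build k F F _ xi lin_xi.
pose L : {linear F -> F} := HB.pack xi i.
by exists L.
Qed.

Section OneDerivation.
Variables (xi : {linear F -> F}) (Dxi : Der_plus xi).

Let leib f g : xi (f * g) = xi f * g + f * xi g.
Proof. by case: Dxi => -[]. Qed.

Lemma der_one : xi 1 = 0.
Proof.
have := leib 1 1; rewrite !mulr1 mul1r => E.
by apply: (addrI (xi 1)); rewrite addr0 -E.
Qed.

Lemma der_vanish N f : vanish N f -> vanish N (xi f).
Proof.
have xi_m g : vanish 1 g -> vanish 1 (xi g).
  by case: Dxi => _ xim /vanish1P g0; apply/vanish1P/xim.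
elim: N f => [|N IHN] f vf; first by [].
rewrite (maxideal_expand (f := f)); last exact/vanish1P/(vanish_leq _ vf).
rewrite linear_sum; apply: vanish_sum => i _; rewrite leib.
have vs := vanish_shift i vf.
apply: vanishD; rewrite -add1n; apply: vanishM => //.
- exact/xi_m/vanish_var.
- exact: vanish_var.
- exact: IHN.
Qed.

Lemma der_maxideal f : maxideal (xi f).
Proof.
apply/vanish1P; rewrite [f]ncseries_expand linearD linearZ /= der_one.
rewrite scaler0 add0r.
apply: der_vanish; apply: vanish_sum => i _.
by rewrite -[1%N]addn0; apply: vanishM => //; apply: vanish_var.
Qed.

Lemma iter_der_vanish N i f : vanish N f -> vanish N (iter i xi f).
Proof. by move=> vf; elim: i => //= i; apply: der_vanish. Qed.

Lemma stable_vanish N : stable_submod xi (vanish N).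
Proof. by split; [apply: vanish0|apply: vanish_lin|apply: der_vanish]. Qed.

Lemma iterD_der i f g : iter i xi (f + g) = iter i xi f + iter i xi g.
Proof. by elim: i => //= i ->; rewrite linearD. Qed.

(** Nilpotency on m / m^2 passes to each layer m^j / m^(j+1): if xi^e1 kills
the first layer and xi^e the j-th, then xi^(e1 + e) kills the next one, by the
iterated Leibniz rule on products of an x_i with an element of m^j. *)
Lemma nilpotent_vanish N : nilpotent_der xi ->
  exists e, forall f, maxideal f -> vanish N (iter e xi f).
Proof.
case=> e1 nil1.
have layer j : exists e, forall f, vanish j.+1 f -> vanish j.+2 (iter e xi f).
  elim: j => [|j [e IHj]].
    by exists e1 => f /vanish1P mf; apply/vanish2P/nil1.
  exists (e1 + e)%N => f vf.
  rewrite (maxideal_expand (f := f)); last exact/vanish1P/(vanish_leq _ vf).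
  have -> : iter (e1 + e) xi (\sum_i ncvar k i * ncshift i f)
             = \sum_i iter (e1 + e) xi (ncvar k i * ncshift i f).
    apply: (big_morph (iter (e1 + e) xi)) => [u v|]; first exact: iterD_der.
    by elim: (e1 + e)%N => //= d ->; rewrite linear0.
  apply: vanish_sum => i _.
  have vs := vanish_shift i vf; have vx := @vanish_var k n i.
  apply: (iter_leibniz (linearD xi) leib (@vanishD _ _ _)) => a b ab.
  have [le_e1a|lt_ae1] := leqP e1 a.
    rewrite -(subnK le_e1a) iterD; apply: (@vanishM _ _ 2 j.+1).
      by apply: iter_der_vanish; apply/vanish2P/nil1/vanish1P.
    exact: iter_der_vanish.
  have le_eb : (e <= b)%N by rewrite -(leq_add2l e1) -ab leq_add2r ltnW.
  rewrite -(subnK le_eb) [iter (b - e + e) _ _]iterD.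
  apply: (@vanishM _ _ 1 j.+2); apply: iter_der_vanish => //; exact: IHj.
case: N => [|N]; first by exists 0%N.
elim: N => [|N [e IHN]]; first by exists 0%N => f /vanish1P.
have [d Hd] := layer N; exists (d + e)%N => f mf.
by rewrite iterD; apply: Hd; apply: IHN.
Qed.

(** Since F / m^(N+1) has a basis of words of length at most N, [xi] acts on it
by a matrix M, and the characteristic polynomial of M is an annihilator. *)
Lemma annihilator N : exists2 chi : {poly k}, chi != 0 &
  forall f, vanish N (pact xi chi f).
Proof.
have [m Dm] : exists m, #|{: N.-bseq 'I_n}| = m.+1.
  have : (0 < #|{: N.-bseq 'I_n}|)%N.
    by apply/card_gt0P; exists (@Bseq N _ [::] isT).
  by case: #|_| => // m _; exists m.
pose word (j : 'I_m.+1) : seq 'I_n := enum_val (cast_ord (esym Dm) j).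
pose mono (v : seq 'I_n) : F := fun w => (w == v)%:R.
pose L f : 'rV[k]_m.+1 := \row_j f (word j).
have wordK w : (size w < N.+1)%N -> exists j, word j = w.
  move=> wN; exists (cast_ord Dm (enum_rank (Bseq (wN : (size w <= N)%N)))).
  by rewrite /word cast_ordK enum_rankK.
have word_inj : injective word.
  by move=> i j /val_inj/enum_val_inj/cast_ord_inj.
have expand f : vanish N.+1 (f - \sum_j L f 0 j *: mono (word j)).
  move=> w /wordK[j <-].
  rewrite ncseriesDE ncseriesNE ncseries_sumE (bigD1 j) //= big1 => [|i ij].
    by rewrite addr0 ncseriesZE /mono eqxx mulr1 mxE subrr.
  by rewrite ncseriesZE /mono (inj_eq word_inj) eq_sym (negPf ij) mulr0.
have Lvanish f : vanish N.+1 f <-> L f = 0.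
  split=> [vf|Lf w /wordK[j <-]].
    by apply/rowP => j; rewrite !mxE vf // ltnS size_bseq.
  by have := congr1 (fun u : 'rV_m.+1 => u 0 j) Lf; rewrite !mxE.
have LP a f g : L (a *: f + g) = a *: L f + L g.
  by apply/rowP => j; rewrite !mxE.
pose M : 'M[k]_m.+1 := \matrix_(j, l) xi (mono (word j)) (word l).
have Lxi f : L (xi f) = L f *m M.
  apply/rowP => l; rewrite !mxE.
  have /(_ (word l)) := der_vanish (expand f).
  rewrite ltnS size_bseq => /(_ isT) /eqP.
  rewrite linearB ncseriesDE ncseriesNE subr_eq0 => /eqP ->.
  rewrite linear_sum ncseries_sumE; apply: eq_bigr => j _.
  by rewrite linearZ /= ncseriesZE [M _ _]mxE.
have Lpact p f : L (pact xi p f) = L f *m horner_mx M p.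
  elim/poly_ind: p => [|p c IHp].
    rewrite rmorph0 mulmx0; apply/Lvanish.
    by rewrite /pact size_poly0 big_ord0.
  rewrite pactDl pactX pactC addrC LP Lxi IHp rmorphD rmorphM /=.
  by rewrite horner_mx_X horner_mx_C mulmxDr mulmxA mul_mx_scalar addrC.
exists (char_poly M); first exact/monic_neq0/char_poly_monic.
move=> f; apply: (@vanish_leq _ _ _ N.+1) => //; apply/Lvanish.
by rewrite Lpact Cayley_Hamilton mulmx0.
Qed.

End OneDerivation.

Lemma Der_plusB (xi eta : F -> F) :
  Der_plus xi -> Der_plus eta -> Der_plus (xi - eta).
Proof.
move=> [[lx dx] mx] [[le de] me]; split; last first.
  move=> f mf; apply/vanish1P; apply: vanishB; apply/vanish1P.
    exact: mx.
  exact: me.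
split=> [a f g|f g] /=; rewrite -?[(xi - eta) _]/(xi _ - eta _).
  by rewrite lx le scalerBr opprD addrACA.
by rewrite dx de mulrBl mulrBr opprD addrACA.
Qed.

(** Let d be the difference of the two derivations: it kills the v i, so d(m) is
contained in d(m^2), and if d(m) lies in m^N then d(m^2) lies in m^(N+1) by the
Leibniz rule.  Hence d(m) lies in every m^N. *)
Lemma derivation_ext (xi eta : F -> F) (v : 'I_n -> F) :
  Der_plus xi -> Der_plus eta -> basis_mod_maxideal2 v ->
  (forall i, xi (v i) = eta (v i)) -> xi = eta.
Proof.
move=> Dxi Deta [_ _ span] eq_v; have D := Der_plusB Dxi Deta.
have [d Dd] := Der_plus_linear D; rewrite Dd in D.
have dv i : d (v i) = 0.
  by rewrite -Dd -[(xi - eta) _]/(xi _ - eta _) eq_v subrr.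
have d_m N f : maxideal f -> vanish N.+1 (d f).
  elim: N f => [|N IHN] f mf; first exact/vanish1P/der_maxideal.
  have [c m2] := span f mf; rewrite -[f](subrK (\sum_i c i *: v i)) linearD.
  apply: vanishD; last first.
    rewrite linear_sum; apply: vanish_sum => i _.
    by rewrite linearZ /= dv scaler0.
  case: m2 => r [a [b [ma mb ->]]].
  rewrite linear_sum; apply: vanish_sum => i _.
  case: (D) => -[_ ->] _; apply: vanishD.
    rewrite -addn1; apply: vanishM; [exact: IHN|exact/vanish1P].
  rewrite -add1n; apply: vanishM; [exact/vanish1P|exact: IHN].
apply/funext => f; apply/eqP; rewrite -subr_eq0; apply/eqP.
rewrite -[_ - _]/((xi - eta) f) Dd; apply: vanish_all => N.
apply: (@vanish_leq _ _ _ N.+1) => //.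
rewrite [f]ncseries_expand linearD linearZ /= der_one // scaler0 add0r.
apply/d_m/vanish1P; apply: vanish_sum => i _.
by rewrite -[1%N]addn0; apply: vanishM => //; apply: vanish_var.
Qed.

End PositiveDerivations.

(** * Functional calculus and the Jordan decomposition *)

Section FunctionalCalculus.
Variables (k : fieldType) (k_closed : polynomials_split k) (n : nat).
Local Notation F := (ncseries k n).
Implicit Types (f g h u : F) (c : k -> k).
Variables (xi : {linear F -> F}) (Dxi : Der_plus xi).

Definition geneig N (nu : k) (e : nat) h : Prop :=
  vanish N (pact xi (('X - nu%:P) ^+ e) h).

(** T is c(xi), where c is seen as a locally constant function on the
spectrum. *)
Definition spectral c (T : F -> F) : Prop :=
  forall N nu e h, geneig N nu e h -> vanish N (T h - c nu *: h).

Lemma der_geneig_ind N : exists E : nat, forall P : F -> Prop,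
  (forall f g, P f -> P g -> P (f + g)) ->
  (forall nu h, geneig N nu E h -> P h) -> forall f, P f.
Proof.
have [chi chi0 chiN] := annihilator Dxi N.
exact: (geneig_ind k_closed (stable_vanish Dxi N) chi0 chiN).
Qed.

(** Used with d a difference of two maps: identities between operators need only
be checked on generalized eigenvectors, with the precision at which these are
given, since the powers of m have zero intersection. *)
Lemma geneig_eq0 (d : F -> F) :
  (forall f g, d (f + g) = d f + d g) ->
  (forall N nu e h, geneig N nu e h -> vanish N (d h)) -> forall f, d f = 0.
Proof.
move=> dD dg f; apply: vanish_all => N.
have [E ind] := der_geneig_ind N; elim/ind: f => [f g|nu h]; last exact: dg.
by rewrite dD; apply: vanishD.
Qed.

Lemma geneig_leq M N nu e h : (M <= N)%N -> geneig N nu e h -> geneig M nu e h.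
Proof. exact: vanish_leq. Qed.

Lemma vanish_geneig N nu f : vanish N f -> geneig N nu 0 f.
Proof. by rewrite /geneig expr0 pact1. Qed.

Lemma geneigM N nu mu d e f g : geneig N nu d f -> geneig N mu e g ->
  geneig N (nu + mu) (d + e) (f * g).
Proof.
rewrite /geneig !pactXsubCn => gf gg.
have st (la : k) i j h : vanish N (iter j (fun w => xi w - la *: w) h) ->
    (j <= i)%N -> vanish N (iter i (fun w => xi w - la *: w) h).
  move=> vh /subnK <-; rewrite iterD -pactXsubCn.
  exact: submod_pact (stable_vanish Dxi N) _ _ vh.
pose sh (la : k) (w : F) := xi w - la *: w.
apply: (@iter_leibniz _ (sh (nu + mu)) (sh nu) (sh mu) (vanish N)).
- by move=> u v; rewrite /sh linearD scalerDr opprD addrACA.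
- move=> u v; rewrite /sh; case: Dxi => -[_ ->] _.
  rewrite mulrBl mulrBr scalerDl opprD addrACA scalerAl.
  by rewrite scalerAr.
- exact: vanishD.
- move=> i j ij; have [le_di|lt_id] := leqP d i.
    by rewrite -[N]addn0; apply: vanishM => //; apply: st gf le_di.
  rewrite -[N]add0n; apply: vanishM => //; apply: st gg _.
  by rewrite -(leq_add2l d) -ij leq_add2r ltnW.
Qed.

(** The coefficient of c(xi) f at a word w is read off p_N(xi) f for any N
greater than the length of w; the choice of N does not matter because, for
M <= N, a generalized eigenvector modulo m^N is one modulo m^M, and p_N(xi) and
p_M(xi) multiply it by the same scalar modulo m^M. *)
Lemma spectral_exists c : exists T : {linear F -> F}, spectral c T.
Proof.
have /choice[p pP] : forall N, exists p : {poly k}, forall nu e h,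
    geneig N nu e h -> vanish N (pact xi p h - c nu *: h).
  move=> N; have [chi chi0 chiN] := annihilator Dxi N.
  exact: (spectral_interpolation k_closed (stable_vanish Dxi N) chi0 chiN c).
pose T f : F := fun w => pact xi (p (size w).+1) f w.
have linT : linear T by move=> a f g; apply/funext => w; rewrite /T pactP.
pose i := GRing.isLinear.Build k F F _ T linT.
pose L : {linear F -> F} := HB.pack T i.
exists L => N nu e h gh; rewrite -[L h]/(T h).
apply: (vanish_trans _ (pP N nu e h gh)) => w wN.
have [E ind] := der_geneig_ind N.
suff /eqP : L h w = pact xi (p N) h w.
  by rewrite -subr_eq0 => /eqP; rewrite ncseriesDE ncseriesNE.
elim/ind: h {gh} => [f g ef eg|mu h gh].
  by rewrite linearD pactDr !ncseriesDE ef eg.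
have := pP _ _ _ _ (geneig_leq wN gh) w (ltnSn _).
have := pP _ _ _ _ gh w wN.
rewrite !ncseriesDE !ncseriesNE => /eqP; rewrite subr_eq0 => /eqP ->.
by move=> /eqP; rewrite subr_eq0 => /eqP <-.
Qed.

(** Elements of m^N are generalized eigenvectors modulo m^N, for any eigenvalue
and with exponent 0. *)
Lemma spectral_vanish c (T : F -> F) N f :
  spectral c T -> vanish N f -> vanish N (T f).
Proof.
move=> cT vf; rewrite -[T f](subrK (c 0 *: f)).
apply: vanishD; last exact: vanishZ.
exact: cT (vanish_geneig 0 vf).
Qed.

Lemma pact_comm (eta : {linear F -> F}) p f :
  (forall g, eta (xi g) = xi (eta g)) -> eta (pact xi p f) = pact xi p (eta f).
Proof.
move=> comm; rewrite /pact linear_sum; apply: eq_bigr => i _.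
rewrite linearZ /=; congr (_ *: _).
by elim: (i : nat) => //= j <-.
Qed.

Lemma spectral_comm c (T eta : {linear F -> F}) :
  spectral c T -> Der_plus eta ->
  (forall g, eta (xi g) = xi (eta g)) -> forall f, eta (T f) = T (eta f).
Proof.
move=> cT Deta comm f; apply/eqP; rewrite -subr_eq0; apply/eqP; move: f.
apply: (@geneig_eq0 (fun f => eta (T f) - T (eta f))) => [f g|N nu e h gh];
  first by rewrite !linearD addrACA.
apply: (@vanish_trans _ _ _ _ (c nu *: eta h)).
  by rewrite -linearZ -linearB; apply: der_vanish => //; apply: cT gh.
apply: vanish_sym; apply: (cT N nu e).
by rewrite /geneig -pact_comm //; apply: der_vanish.
Qed.

(** A generalized eigenvector h of xi modulo m^N lifts to an exact eigenvector u
of S: take for u the image of h under the projection c(xi), for c the indicator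
function of nu. *)
Lemma spectral_eigen (S : {linear F -> F}) : spectral id S ->
  forall N nu e h, geneig N nu e h ->
  exists2 u, S u = nu *: u & vanish N (h - u).
Proof.
move=> idS N nu e h gh.
have [p piP] := spectral_exists (fun z => (z == nu)%:R).
exists (p h); last first.
  by apply: vanish_sym; have := piP _ _ _ _ gh; rewrite eqxx scale1r.
apply/eqP; rewrite -subr_eq0; apply/eqP; move: h {gh}.
apply: (@geneig_eq0 (fun h => S (p h) - nu *: p h)) => [f g|M mu d h gh];
  first by rewrite !linearD addrACA.
set b : k := (mu == nu)%:R.
have pib := piP _ _ _ _ gh; rewrite -/b in pib.
apply: (@vanish_trans _ _ _ _ (S (b *: h))).
  by rewrite -linearB; apply: spectral_vanish idS _.
apply: (@vanish_trans _ _ _ _ (nu *: (b *: h))); last first.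
  by rewrite -scalerBr; apply: vanishZ; apply: vanish_sym.
rewrite linearZ /= scalerA mulrC -scalerA -scalerBr /b.
case: eqP => [<-|_]; last by rewrite scale0r.
by apply: vanishZ; apply: idS gh.
Qed.

(** By bilinearity modulo m^N it suffices to compare both sides of the Leibniz
rule on generalized eigenvectors f and g, for nu and mu; both are congruent to
(nu + mu) f g. *)
Lemma spectral_der (S : {linear F -> F}) : spectral id S -> Der_plus S.
Proof.
move=> idS; split; last first.
  by move=> f /vanish1P vf; apply/vanish1P/(spectral_vanish idS).
split=> [a f g|f g]; first exact: linearP.
apply/eqP; rewrite -subr_eq0; apply/eqP; apply: vanish_all => N.
have [E ind] := der_geneig_ind N; elim/ind: f g => [f1 f2 If1 If2 g|nu f gf].
  have -> : S ((f1 + f2) * g) - (S (f1 + f2) * g + (f1 + f2) * S g)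
    = (S (f1 * g) - (S f1 * g + f1 * S g))
       + (S (f2 * g) - (S f2 * g + f2 * S g)).
    rewrite mulrDl ![S (_ + _)]linearD !mulrDl.
    by rewrite [X in _ - X]addrACA opprD addrACA.
  exact: vanishD.
move=> g; elim/ind: g => [g1 g2 Ig1 Ig2|mu g gg].
  have -> : S (f * (g1 + g2)) - (S f * (g1 + g2) + f * S (g1 + g2))
    = (S (f * g1) - (S f * g1 + f * S g1))
       + (S (f * g2) - (S f * g2 + f * S g2)).
    rewrite mulrDr ![S (_ + _)]linearD !mulrDr.
    by rewrite [X in _ - X]addrACA opprD addrACA.
  exact: vanishD.
apply: (@vanish_trans _ _ _ _ ((nu + mu) *: (f * g))).
  exact: idS (geneigM gf gg).
rewrite scalerDl opprD addrACA {1}scalerAl scalerAr -mulrBl -mulrBr.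
apply: vanishD.
  rewrite -[N]addn0; apply: vanishM => //.
  by apply: vanish_sym; apply: idS gf.
rewrite -[N]add0n; apply: vanishM => //.
by apply: vanish_sym; apply: idS gg.
Qed.

(** On a generalized eigenvector for nu, L = xi - S acts as xi - nu modulo m^2,
and the exponent E of the primary decomposition is uniform. *)
Lemma spectral_nilpotent (S L : {linear F -> F}) :
  spectral id S -> Der_plus L ->
  (forall f, L f = xi f - S f) -> nilpotent_der L.
Proof.
move=> idS DL LE; have [E ind] := der_geneig_ind 2.
exists E => f _; apply/vanish2P; elim/ind: f => [f g|nu h gh].
  by rewrite iterD_der; apply: vanishD.
suff close i : vanish 2 (iter i L h - pact xi (('X - nu%:P) ^+ i) h).
  rewrite -[iter E L h](subrK (pact xi (('X - nu%:P) ^+ E) h)).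
  exact: vanishD.
elim: i => [|i IHi]; first by rewrite expr0 pact1 subrr.
rewrite exprS pactM pactXsubC iterS; set y := pact _ _ h in IHi *.
apply: (@vanish_trans _ _ _ _ (L y)).
  by rewrite -linearB; apply: der_vanish.
rewrite LE opprB addrC addrA subrK; apply: vanish_sym; apply: (idS 2 nu E).
rewrite /geneig -pactM mulrC pactM.
exact: submod_pact (stable_vanish Dxi 2) _ _ gh.
Qed.

Lemma der_const_coef (S : F -> F) f : Der_plus S -> (S f) [::] = 0.
Proof.
move=> DS; have [L DL] := Der_plus_linear DS.
by rewrite DL in DS *; apply: der_maxideal.
Qed.

(** The linear parts of eigenvectors of S in m span k^n, so a free family of them
that has fewer than n members can be extended. *)
Lemma spectral_semisimple (S : {linear F -> F}) :
  spectral id S -> semisimple_der S.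
Proof.
move=> idS; have DS := spectral_der idS.
have [E ind] := der_geneig_ind 2.
have build r : (r <= n)%N -> exists X : seq F, [/\ size X = r,
    forall u : F, u \in X -> maxideal u /\ exists c : k, S u = c *: u
    & free (map (@linpart k n) X)].
  elim: r => [_|r IHr lt_rn].
    by exists [::]; split=> //; rewrite nil_free.
  have [X [sX mX eX]] := IHr (ltnW lt_rn).
  have [[u [mu [c Su]] lu]|noU] := pselect (exists2 u : F,
      maxideal u /\ (exists c : k, S u = c *: u)
      & linpart u \notin <<map (@linpart k n) X>>%VS).
    exists (u :: X); split=> /=; rewrite ?sX //.
      by move=> v; rewrite inE => /predU1P[-> |/mX //]; split=> //; exists c.
    by rewrite free_cons lu.
  suff full : (fullv <= <<map (@linpart k n) X>>)%VS.
    have := leq_trans (dimvS full) (dim_span _).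
    by rewrite dimvf /dim /= mul1n size_map sX leqNgt lt_rn.
  have inX f : linpart f \in <<map (@linpart k n) X>>%VS.
    elim/ind: f => [f g Xf Xg|nu h gh].
      by rewrite -[f]scale1r linpartP scale1r memvD.
    have [u Su hu] := spectral_eigen idS gh.
    have c0 : nu * u [::] = 0 by rewrite -ncseriesZE -Su der_const_coef.
    (* Removing the constant term of u lands in m and keeps S u = nu u: S
       kills 1, and u has no constant term when nu is not 0. *)
    have mu : maxideal (u - u [::] *: 1).
      rewrite /maxideal /= ncseriesDE ncseriesNE ncseriesZE ncseries1E.
      by rewrite mulr1 subrr.
    have -> : linpart h = linpart (u - u [::] *: 1).
      apply/rowP => i; rewrite !mxE ncseriesDE ncseriesNE ncseriesZE ncseries1E.
      rewrite mulr0 subr0; apply/eqP; rewrite -subr_eq0; apply/eqP.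
      exact: (hu [:: i]).
    apply: contrapT => /negP uX; apply: noU; exists (u - u [::] *: 1) => //.
    split=> //; exists nu.
    rewrite linearB linearZ /= der_one // scaler0 subr0.
    by rewrite scalerBr scalerA c0 scale0r subr0.
  apply/subvP => v _.
  have -> : v = linpart (fun w => if w is [:: i] then v 0 i else 0).
    by apply/rowP => i; rewrite mxE.
  exact: inX.
have [X [sX mX eX]] := build n (leqnn n).
pose Y : n.-tuple 'rV[k]_n := tcast sX (map_tuple (@linpart k n) (in_tuple X)).
have YE i : Y`_i = linpart X`_i.
  rewrite /Y val_tcast /=; have [lt_iX|le_Xi] := ltnP i (size X).
    by rewrite (nth_map 0).
  rewrite !nth_default ?size_map //.
  by apply/rowP => j; rewrite !mxE.
have freeY : free Y by rewrite /Y val_tcast.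
have inX (i : 'I_n) : X`_i \in X by rewrite mem_nth // sX.
exists (fun i : 'I_n => X`_i); split=> [i|].
  have [_ eig] := mX _ (inX i); split=> //; apply/eqP => Xi0.
  have := free_not0 freeY (mem_nth 0 (_ : i < size Y)%N).
  rewrite size_tuple ltn_ord => /(_ isT); rewrite YE Xi0 => /eqP; apply.
  by apply/rowP => j; rewrite !mxE.
have lin0 (c : 'I_n -> k) : maxideal (\sum_(i < n) c i *: X`_i).
  apply/vanish1P; apply: vanish_sum => i _; apply: vanishZ.
  by apply/vanish1P; case: (mX _ (inX i)).
split=> [i|c /vanish2P|f mf]; first by case: (mX _ (inX i)).
  rewrite (vanish2_linpart (lin0 c)) linpart_sum => lc.
  move/freeP: freeY; apply; rewrite -[RHS]lc.
  by apply: eq_bigr => i _; rewrite YE.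
have Yfull : linpart f \in <<Y>>%VS.
  suff -> : <<Y>>%VS = fullv by exact: memvf.
  apply/eqP; rewrite -dimv_leqif_eq ?subvf // dimvf /dim /= mul1n.
  by move: freeY; rewrite /free => /eqP ->; rewrite size_tuple.
exists (fun i => coord Y i (linpart f)); apply/vanish2P/vanish2_linpart.
  apply/vanish1P; apply: vanishB; apply/vanish1P => //; exact: lin0.
rewrite -scaleN1r addrC linpartP linpart_sum scaleN1r {2}(coord_span Yfull).
rewrite addrC; apply/eqP; rewrite subr_eq0; apply/eqP/eq_bigr => i _.
by rewrite YE.
Qed.

Lemma spectral_jordan (S : {linear F -> F}) :
  spectral id S -> jordan_decomposition xi S ((xi : F -> F) - (S : F -> F)).
Proof.
move=> idS; have DS := spectral_der idS; have DN := Der_plusB Dxi DS.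
have [L LE] := Der_plus_linear DN.
split=> //; first by rewrite addrC subrK.
- exact: spectral_semisimple.
- by rewrite LE in DN *; apply: spectral_nilpotent idS DN _ => f; rewrite -LE.
apply/funext => f.
rewrite -[LHS]/(S (xi f - S f) - (xi (S f) - S (S f))) linearB.
by rewrite (spectral_comm idS Dxi (fun g => erefl)) subrr.
Qed.

(** Each eigenvector of xiS in the given basis of m / m^2 is a generalized
eigenvector of xi modulo every power of m, for the same eigenvalue: there xiN
acts as xi - mu, and it is nilpotent modulo m^N. *)
Lemma jordan_spectral (S : {linear F -> F}) (xiS xiN : F -> F) :
  spectral id S -> jordan_decomposition xi xiS xiN -> xiS = S.
Proof.
move=> idS [[DS DN] xiE [v [eig_v basis_v]] nilN comm].
have [L LE] := Der_plus_linear DN; rewrite LE in DN nilN comm xiE.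
have [S' S'E] := Der_plus_linear DS; rewrite S'E in DS comm xiE eig_v *.
have commf f : S' (L f) = L (S' f).
  apply/eqP; rewrite -subr_eq0; apply/eqP.
  exact: (congr1 (fun d : F -> F => d f) comm).
apply: (derivation_ext DS (spectral_der idS) basis_v) => i.
have xiF f : xi f = S' f + L f by apply: (congr1 (fun d : F -> F => d f) xiE).
have [_ [mu S'v]] := eig_v i.
have iterN j : S' (iter j L (v i)) = mu *: iter j L (v i).
  by elim: j => //= j IHj; rewrite commf IHj linearZ.
have shiftN j : pact xi (('X - mu%:P) ^+ j) (v i) = iter j L (v i).
  elim: j => [|j IHj]; first by rewrite expr0 pact1.
  rewrite exprS pactM IHj pactXsubC -iterN xiF.
  by rewrite addrAC subrr add0r.
rewrite S'v; apply/eqP; rewrite -subr_eq0; apply/eqP; apply: vanish_all => N.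
have [e nil_e] := nilpotent_vanish DN N nilN.
apply: vanish_sym; apply: (idS N mu e); rewrite /geneig shiftN.
by apply: nil_e; case: basis_v.
Qed.

(** A map commuting with [xi] commutes with c(xi), by [spectral_comm]; the
converse holds because the bracket is additive in its second argument. *)
Lemma jordan_centralizer (S : {linear F -> F}) (eta : F -> F) :
  spectral id S -> Der_plus eta ->
  der_bracket eta xi = 0 <->
  der_bracket eta S = 0 /\ der_bracket eta ((xi : F -> F) - (S : F -> F)) = 0.
Proof.
move=> idS Deta; have [L LE] := Der_plus_linear Deta; rewrite LE in Deta *.
split=> [comm | [commS commN]].
  have commf f : L (xi f) = xi (L f).
    apply/eqP; rewrite -subr_eq0; apply/eqP.
    exact: (congr1 (fun d : F -> F => d f) comm).
  have commSf := spectral_comm idS Deta commf.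
  split; apply/funext => f.
    by rewrite -[LHS]/(L (S f) - S (L f)) commSf subrr.
  rewrite -[LHS]/(L (xi f - S f) - (xi (L f) - S (L f))) linearB.
  by rewrite commf commSf subrr.
apply/funext => f.
have : der_bracket L S f + der_bracket L ((xi : F -> F) - (S : F -> F)) f = 0.
  by rewrite commS commN addr0.
rewrite -[der_bracket L S f]/(L (S f) - S (L f)).
rewrite -[der_bracket L _ f]/(L (xi f - S f) - (xi (L f) - S (L f))).
rewrite linearB opprB addrACA [L (S f) + _]addrC subrK.
by rewrite [- S _ + _]addrC addrAC subrr add0r.
Qed.

End FunctionalCalculus.

Theorem theorem3p5 (k : closedFieldType) (n : nat) (hn : (1 <= n)%N)
    (xi : ncseries k n -> ncseries k n) (hxi : Der_plus xi) :
  (exists! p : (ncseries k n -> ncseries k n) * (ncseries k n -> ncseries k n),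
      jordan_decomposition xi p.1 p.2) /\
  (forall xiS xiN : ncseries k n -> ncseries k n,
      jordan_decomposition xi xiS xiN ->
      forall eta : ncseries k n -> ncseries k n, Der_plus eta ->
        (der_bracket eta xi = 0%R <->
         der_bracket eta xiS = 0%R /\ der_bracket eta xiN = 0%R)).
Proof.
have k_closed : polynomials_split k.
  by move=> p; have [r pE] := closed_field_poly_normal p; exists r.
have [L xiE] := Der_plus_linear hxi; rewrite xiE in hxi *.
have [S idS] := spectral_exists k_closed hxi id.
have uniqS xiS xiN : jordan_decomposition L xiS xiN ->
    xiS = S /\ xiN = (L : _ -> _) - (S : _ -> _).
  move=> J; have SE := jordan_spectral k_closed hxi idS J.
  by case: J => _ LE _ _ _; rewrite LE -SE addrC addKr.
split.
  exists (S : _ -> _, (L : _ -> _) - (S : _ -> _)).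
  split; first exact: spectral_jordan.
  by move=> [xiS xiN] /uniqS[/= -> ->].
move=> xiS xiN /uniqS[-> ->] eta Deta.
exact: jordan_centralizer.
Qed.
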